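(* (1) The Grothendieck construction $\int\mathbf{P}$ of the doctrine $\mathbf{P}:(\mathbf{SL}^{op})^{op}\to\mathbf{PreOrd}$ is exactly the category $\mathbf{BTop}$ of basic topologies, and the forgetful functor $\mathbf{U}:\int\mathbf{P}\to\mathbf{SL}^{op}$, $(L,\Phi)\mapsto L$, is a fibration. (2) The Grothendieck construction $\int\widetilde{\mathbf{P}}$ of the doctrine $\widetilde{\mathbf{P}}:\mathbf{Loc}^{op}\to\mathbf{PreOrd}$ is exactly the category $\mathbf{PTop}$ of positive topologies; the forgetful functor $\mathbf{U}:\int\widetilde{\mathbf{P}}\to\mathbf{Loc}$, $(L,\Phi)\mapsto L$, is a fibration, and it fits in a pullback square in $\mathbf{Cat}$ with $\mathbf{U}:\int\mathbf{P}\to\mathbf{SL}^{op}$ along the inclusion $\mathbf{Loc}\hookrightarrow\mathbf{SL}^{op}$, the top side of the square being the inclusion $\int\widetilde{\mathbf{P}}\hookrightarrow\int\mathbf{P}$.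
   Context: The foundational framework is intuitionistic and impredicative (e.g. the internal language of a topos); excluded middle is not assumed. A suplattice is a poset with all joins; $\mathbf{SL}$ is the category of suplattices and join-preserving maps (suplattice homomorphisms). $\Omega=\mathcal{P}(1)$ is the suplattice (frame) of truth values. For suplattices $X,L$, the set $\mathbf{SL}(X,L)$ of homomorphisms is a suplattice under pointwise joins. A sub-suplattice (subobject) of a suplattice is a subset closed under arbitrary joins; $\mathbf{Sub}(L)$ is the preorder of sub-suplattices of $L$ ordered by inclusion, and for $g:M\to L$ in $\mathbf{SL}$, $\mathbf{Sub}(g)(I)=\{x\in M\mid g(x)\in I\}$. $\mathbf{Frm}$ is the subcategory of $\mathbf{SL}$ whose objects are frames (binary meets distribute over arbitrary joins) and whose arrows preserve arbitrary joins and finite meets; $\mathbf{Loc}=\mathbf{Frm}^{op}$. The functor $\mathbf{P}:\mathbf{SL}\to\mathbf{PreOrd}$ is the composite $\mathbf{Sub}\circ\mathbf{SL}(-,\Omega)$: $\mathbf{P}(L)$ is the preorder of sub-suplattices of $\mathbf{SL}(L,\Omega)$, and for $f:M\to L$ in $\mathbf{SL}$ and $\Psi\in\mathbf{P}(M)$, $\mathbf{P}(f)(\Psi)=\{\varphi\in\mathbf{SL}(L,\Omega)\mid\varphi\circ f\in\Psi\}$. It is regarded as a doctrine (a contravariant $\mathbf{PreOrd}$-valued functor) on $\mathbf{SL}^{op}$. The functor $\widetilde{\mathbf{P}}:\mathbf{Loc}^{op}=\mathbf{Frm}\to\mathbf{PreOrd}$ is the restriction of $\mathbf{P}$ to frames.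 The Grothendieck construction $\int\mathbf{D}$ of a doctrine $\mathbf{D}:\mathbb{C}^{op}\to\mathbf{PreOrd}$ has as objects the pairs $(A,\Phi)$ with $A$ an object of $\mathbb{C}$ and $\Phi\in\mathbf{D}(A)$, and as arrows $(A,\Phi)\to(B,\Psi)$ the arrows $f:A\to B$ of $\mathbb{C}$ with $\Phi\le\mathbf{D}(f)(\Psi)$. $\mathbf{BTop}$ is the category whose objects are pairs $(L,\Phi)$ of a suplattice $L$ and a sub-suplattice $\Phi$ of $\mathbf{SL}(L,\Omega)$, and whose arrows $(L_1,\Phi_1)\to(L_2,\Phi_2)$ are suplattice homomorphisms $f:L_2\to L_1$ such that $\Phi_1\circ f\subseteq\Phi_2$, where $\Phi_1\circ f=\{\varphi\circ f\mid\varphi\in\Phi_1\}$. $\mathbf{PTop}$ is the subcategory of $\mathbf{BTop}$ consisting of the objects $(L,\Phi)$ with $L$ a frame and the arrows which are frame homomorphisms between the underlying frames. *)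

(* Defs.v *)
(* Everything below is constructive: equality of truth values and of functions is
   extensional (as in the internal language of a topos), excluded middle and choice
   are not used. *)
From Stdlib Require Import FunctionalExtensionality PropExtensionality ClassicalFacts.

Set Implicit Arguments.
Unset Strict Implicit.
Unset Printing Implicit Defensive.

Lemma proof_irrel (P : Prop) (p q : P) : p = q.
Proof. exact (ext_prop_dep_proof_irrel_cic propositional_extensionality P p q). Qed.

Lemma pred_ext (X : Type) (S T : X -> Prop) : (forall x, S x <-> T x) -> S = T.
Proof.
  intro H; apply functional_extensionality; intro x.
  apply propositional_extensionality; apply H.
Qed.

Lemma sig_ext (X : Type) (S : X -> Prop) (u v : sig S) : proj1_sig u = proj1_sig v -> u = v.
Proof.
  destruct u as [x p], v as [y q]; simpl; intro e; destruct e.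
  f_equal; apply proof_irrel.
Qed.

Record Category := {
  Ob : Type;
  Hom : Ob -> Ob -> Type;
  idm : forall A, Hom A A;
  comp : forall A B C, Hom B C -> Hom A B -> Hom A C;
  comp_idl : forall A B (f : Hom A B), comp (idm B) f = f;
  comp_idr : forall A B (f : Hom A B), comp f (idm A) = f;
  comp_assoc : forall A B C D (h : Hom C D) (g : Hom B C) (f : Hom A B),
    comp h (comp g f) = comp (comp h g) f }.

Arguments Hom {c} A B.
Arguments idm {c} A.
Arguments comp {c A B C} g f.

Record Functor (C D : Category) := {
  fobj :> Ob C -> Ob D;
  fhom : forall A B : Ob C, Hom A B -> Hom (fobj A) (fobj B);
  fhom_id : forall A : Ob C, fhom (idm A) = idm (fobj A);
  fhom_comp : forall (A B E : Ob C) (g : Hom B E) (f : Hom A B),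
    fhom (comp g f) = comp (fhom g) (fhom f) }.

Arguments fhom {C D} F {A B} f : rename.

Definition op (C : Category) : Category := {|
  Ob := Ob C;
  Hom := fun A B => @Hom C B A;
  idm := fun A => @idm C A;
  comp := fun A B E g f => @comp C E B A f g;
  comp_idl := fun A B f => comp_idr f;
  comp_idr := fun A B f => comp_idl f;
  comp_assoc := fun A B E D h g f => eq_sym (comp_assoc f g h) |}.

Definition opF (C D : Category) (F : Functor C D) : Functor (op C) (op D) :=
  @Build_Functor (op C) (op D) F (fun A B f => @fhom C D F B A f)
    (fun A => fhom_id F A) (fun A B E g f => @fhom_comp C D F E B A f g).

Definition idF (C : Category) : Functor C C :=
  @Build_Functor C C (fun A => A) (fun _ _ f => f) (fun _ => eq_refl) (fun _ _ _ _ _ => eq_refl).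

Definition compF (C D E : Category) (G : Functor D E) (F : Functor C D) : Functor C E.
Proof.
  refine (@Build_Functor C E (fun A => G (F A)) (fun A B f => fhom G (fhom F f)) _ _).
  - abstract (intro A; rewrite fhom_id; apply fhom_id).
  - abstract (intros A B X g f; rewrite fhom_comp; apply fhom_comp).
Defined.

(** Used to say that an equality of categories is compatible with given functors. *)
Definition idF_of_eq (C D : Category) (e : C = D) : Functor C D :=
  match e in _ = X return Functor C X with eq_refl => idF C end.

Definition Subcategory (C : Category) (PO : Ob C -> Prop)
    (PH : forall A B : Ob C, Hom A B -> Prop)
    (PH_id : forall A, PO A -> PH A A (idm A))
    (PH_comp : forall A B D (g : Hom B D) (f : Hom A B),
       PO A -> PO B -> PO D -> PH B D g -> PH A B f -> PH A D (comp g f)) : Category.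
Proof.
  refine (@Build_Category {A : Ob C | PO A}
    (fun A B => {f : Hom (proj1_sig A) (proj1_sig B) | PH _ _ f})
    (fun A => exist _ (idm (proj1_sig A)) (PH_id _ (proj2_sig A)))
    (fun A B D g f => exist _ (comp (proj1_sig g) (proj1_sig f))
       (PH_comp _ _ _ _ _ (proj2_sig A) (proj2_sig B) (proj2_sig D)
          (proj2_sig g) (proj2_sig f))) _ _ _);
  abstract (intros; apply sig_ext; first [apply comp_idl | apply comp_idr | apply comp_assoc]).
Defined.

Definition Subcategory_incl (C : Category) (PO : Ob C -> Prop)
    (PH : forall A B : Ob C, Hom A B -> Prop) PH_id PH_comp :
    Functor (@Subcategory C PO PH PH_id PH_comp) C :=
  @Build_Functor (@Subcategory C PO PH PH_id PH_comp) C
    (fun A => proj1_sig A) (fun A B f => proj1_sig f)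
    (fun _ => eq_refl) (fun _ _ _ _ _ => eq_refl).

(** Functors are compared strictly, as arrows of Cat.

      A --top--> B
      |          |
    left       right
      v          v
      C --bot--> D *)
Definition is_pullback_Cat (A B C D : Category) (top : Functor A B) (left : Functor A C)
    (right : Functor B D) (bot : Functor C D) : Prop :=
  compF bot left = compF right top /\
  forall (X : Category) (H : Functor X C) (K : Functor X B),
    compF bot H = compF right K ->
    exists! u : Functor X A, compF left u = H /\ compF top u = K.

Definition is_cartesian (E B : Category) (U : Functor E B) (X Y : Ob E) (f : Hom X Y) : Prop :=
  forall (Z : Ob E) (g : Hom Z Y) (w : Hom (U Z) (U X)),
    comp (fhom U f) w = fhom U g ->
    exists! h : Hom Z X, fhom U h = w /\ comp f h = g.

(** The equation between dependent pairs says that [b' = U X] and [u = U f] strictly. *)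
Definition is_fibration (E B : Category) (U : Functor E B) : Prop :=
  forall (Y : Ob E) (b' : Ob B) (u : Hom b' (U Y)),
    exists (X : Ob E) (f : Hom X Y),
      existT (fun b => Hom b (U Y)) (U X) (fhom U f) = existT (fun b => Hom b (U Y)) b' u /\
      is_cartesian U f.

Record Preorder := {
  pcar :> Type;
  ple : pcar -> pcar -> Prop;
  ple_refl : forall x, ple x x;
  ple_trans : forall x y z, ple x y -> ple y z -> ple x z }.

Definition monotone (X Y : Preorder) (f : X -> Y) : Prop :=
  forall x y : X, ple x y -> ple (f x) (f y).

Definition MonotoneMap (X Y : Preorder) := {f : X -> Y | monotone f}.

Definition monotone_id (X : Preorder) : MonotoneMap X X.
Proof. exists (fun x => x); abstract (intros x y h; exact h). Defined.

Definition monotone_comp (X Y Z : Preorder) (g : MonotoneMap Y Z) (f : MonotoneMap X Y) :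
    MonotoneMap X Z.
Proof.
  exists (fun x => proj1_sig g (proj1_sig f x)).
  abstract (intros x y h; exact (proj2_sig g _ _ (proj2_sig f _ _ h))).
Defined.

Definition PreOrd : Category.
Proof.
  refine (@Build_Category Preorder MonotoneMap monotone_id monotone_comp _ _ _);
  abstract (intros; apply sig_ext; reflexivity).
Defined.

Definition Doctrine (C : Category) := Functor (op C) PreOrd.

(** [reindex D f : D(B) -> D(A)] for [f : A -> B]. *)
Definition reindex (C : Category) (D : Doctrine C) (A B : Ob C) (f : Hom A B) :
    pcar (D B) -> pcar (D A) :=
  proj1_sig (@fhom (op C) PreOrd D B A f).

Arguments reindex {C} D {A B} f _.

Lemma reindex_id (C : Category) (D : Doctrine C) (A : Ob C) (x : pcar (D A)) :
  reindex D (idm A) x = x.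
Proof.
  exact (f_equal (fun k : @Hom PreOrd (D A) (D A) => proj1_sig k x) (fhom_id D A)).
Qed.

Lemma reindex_comp (C : Category) (D : Doctrine C) (A B E : Ob C)
    (g : Hom B E) (f : Hom A B) (x : pcar (D E)) :
  reindex D (comp g f) x = reindex D f (reindex D g x).
Proof.
  exact (f_equal (fun k : @Hom PreOrd (D E) (D A) => proj1_sig k x)
    (@fhom_comp (op C) PreOrd D E B A f g)).
Qed.

Lemma Groth_idm (C : Category) (D : Doctrine C) (A : Ob C) (x : pcar (D A)) :
  ple x (reindex D (idm A) x).
Proof. rewrite reindex_id; apply ple_refl. Qed.

Lemma Groth_comp (C : Category) (D : Doctrine C) (A B E : Ob C) (g : Hom B E) (f : Hom A B)
    (x : pcar (D A)) (y : pcar (D B)) (z : pcar (D E)) :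
  ple y (reindex D g z) -> ple x (reindex D f y) -> ple x (reindex D (comp g f) z).
Proof.
  intros hg hf; rewrite reindex_comp; apply (ple_trans hf).
  exact (proj2_sig (@fhom (op C) PreOrd D B A f) _ _ hg).
Qed.

Definition Groth (C : Category) (D : Doctrine C) : Category.
Proof.
  refine (@Build_Category {A : Ob C & pcar (D A)}
    (fun X Y => {f : Hom (projT1 X) (projT1 Y) | ple (projT2 X) (reindex D f (projT2 Y))})
    (fun X => exist _ (idm (projT1 X)) (Groth_idm (projT2 X)))
    (fun X Y Z g f => exist _ (comp (proj1_sig g) (proj1_sig f))
       (Groth_comp (proj2_sig g) (proj2_sig f))) _ _ _);
  abstract (intros; apply sig_ext; first [apply comp_idl | apply comp_idr | apply comp_assoc]).
Defined.

Definition Groth_forget (C : Category) (D : Doctrine C) : Functor (Groth D) C :=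
  @Build_Functor (Groth D) C (fun X => projT1 X) (fun X Y f => proj1_sig f)
    (fun _ => eq_refl) (fun _ _ _ _ _ => eq_refl).

Definition restrict (B C : Category) (F : Functor B C) (D : Doctrine C) : Doctrine B :=
  compF D (opF F).

Definition Groth_incl (B C : Category) (F : Functor B C) (D : Doctrine C) :
    Functor (Groth (restrict F D)) (Groth D).
Proof.
  refine (@Build_Functor (Groth (restrict F D)) (Groth D)
    (fun X => existT (fun A => pcar (D A)) (F (projT1 X)) (projT2 X))
    (fun X Y f => exist _ (fhom F (proj1_sig f)) (proj2_sig f)) _ _).
  - abstract (intro X; apply sig_ext; apply fhom_id).
  - abstract (intros X Y Z g f; apply sig_ext; apply fhom_comp).
Defined.

(** [join] is given as an operation on subsets; it is determined by the order. *)
Record SupLat := {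
  scar :> Type;
  sle : scar -> scar -> Prop;
  sle_refl : forall x, sle x x;
  sle_trans : forall x y z, sle x y -> sle y z -> sle x z;
  sle_antisym : forall x y, sle x y -> sle y x -> x = y;
  join : (scar -> Prop) -> scar;
  join_ub : forall (S : scar -> Prop) x, S x -> sle x (join S);
  join_lub : forall (S : scar -> Prop) y, (forall x, S x -> sle x y) -> sle (join S) y }.

Arguments sle {s} x y.
Arguments join {s} S.

Definition image (X Y : Type) (f : X -> Y) (S : X -> Prop) : Y -> Prop :=
  fun y => exists x, S x /\ y = f x.

Lemma image_id (X : Type) (S : X -> Prop) : image (fun x => x) S = S.
Proof.
  apply pred_ext; intro x; split.
  - intros [y [Sy e]]; rewrite e; exact Sy.
  - intro Sx; exists x; split; [exact Sx | reflexivity].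
Qed.

Lemma image_comp (X Y Z : Type) (g : Y -> Z) (f : X -> Y) (S : X -> Prop) :
  image g (image f S) = image (fun x => g (f x)) S.
Proof.
  apply pred_ext; intro z; split.
  - intros [y [[x [Sx ey]] ez]]; exists x; split; [exact Sx | rewrite ez, ey; reflexivity].
  - intros [x [Sx ez]]; exists (f x); split; [exists x; split; [exact Sx | reflexivity] | exact ez].
Qed.

Definition preserves_joins (X L : SupLat) (f : X -> L) : Prop :=
  forall S : X -> Prop, f (join S) = join (image f S).

Definition SLHom (X L : SupLat) := {f : X -> L | preserves_joins f}.

Definition SLapp (X L : SupLat) (f : SLHom X L) : X -> L := proj1_sig f.
Coercion SLapp : SLHom >-> Funclass.

Lemma SLHom_ext (X L : SupLat) (f g : SLHom X L) : (forall x, f x = g x) -> f = g.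
Proof. intro h; apply sig_ext; apply functional_extensionality; exact h. Qed.

Definition SLid (X : SupLat) : SLHom X X.
Proof.
  exists (fun x => x); abstract (intro S; rewrite image_id; reflexivity).
Defined.

Definition SLcomp (X Y Z : SupLat) (g : SLHom Y Z) (f : SLHom X Y) : SLHom X Z.
Proof.
  exists (fun x => g (f x)).
  abstract (intro S; rewrite <- image_comp, <- (proj2_sig g); unfold SLapp; f_equal;
    apply (proj2_sig f)).
Defined.

Definition SL : Category.
Proof.
  refine (@Build_Category SupLat SLHom SLid SLcomp _ _ _);
  abstract (intros; apply SLHom_ext; reflexivity).
Defined.

Definition Omega : SupLat.
Proof.
  refine (@Build_SupLat Prop (fun p q => p -> q) (fun _ h => h)
    (fun _ _ _ h k x => k (h x)) _ (fun S => exists p, S p /\ p) _ _).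
  - intros p q h k; apply propositional_extensionality; split; assumption.
  - intros S p Sp hp; exists p; split; assumption.
  - intros S q h [p [Sp hp]]; exact (h p Sp hp).
Defined.

Lemma pointwise_join_preserves_joins (X L : SupLat) (F : SLHom X L -> Prop) :
  preserves_joins (fun x => join (image (fun f : SLHom X L => f x) F)).
Proof.
  intro S.
  apply sle_antisym; apply join_lub.
  - intros y [f [Ff e]]; rewrite e; unfold SLapp; rewrite (proj2_sig f).
    apply join_lub; intros z [x [Sx ez]]; rewrite ez.
    apply (@sle_trans L _ (join (image (fun g : SLHom X L => g x) F))).
    + apply join_ub; exists f; split; [exact Ff | reflexivity].
    + apply join_ub; exists x; split; [exact Sx | reflexivity].
  - intros y [x [Sx e]]; rewrite e.
    apply join_lub; intros z [f [Ff ez]]; rewrite ez.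
    apply (@sle_trans L _ (f (join S))).
    + unfold SLapp; rewrite (proj2_sig f); apply join_ub.
      exists x; split; [exact Sx | reflexivity].
    + apply join_ub; exists f; split; [exact Ff | reflexivity].
Qed.

Definition SLHom_join (X L : SupLat) (F : SLHom X L -> Prop) : SLHom X L :=
  exist _ (fun x => join (image (fun f : SLHom X L => f x) F))
    (pointwise_join_preserves_joins F).

Definition SLHomLat (X L : SupLat) : SupLat.
Proof.
  refine (@Build_SupLat (SLHom X L) (fun f g => forall x, sle (f x) (g x)) _ _ _
    (@SLHom_join X L) _ _).
  - intros f x; apply sle_refl.
  - intros f g h p q x; exact (sle_trans (p x) (q x)).
  - intros f g p q; apply SLHom_ext; intro x; apply sle_antisym; [apply p | apply q].
  - intros F f Ff x; apply join_ub; exists f; split; [exact Ff | reflexivity].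
  - intros F g h x; apply join_lub; intros y [f [Ff e]]; rewrite e; exact (h f Ff x).
Defined.

Definition homSL (L : SupLat) : Functor (op SL) SL.
Proof.
  unshelve refine (@Build_Functor (op SL) SL (fun X => SLHomLat X L)
    (fun X Y (f : SLHom Y X) =>
       exist _ (fun phi : SLHomLat X L => SLcomp phi f : SLHomLat Y L) _) _ _).
  - abstract (intro F; apply SLHom_ext; intro y; simpl; rewrite image_comp; reflexivity).
  - abstract (intro X; apply SLHom_ext; intro phi; apply SLHom_ext; reflexivity).
  - abstract (intros X Y Z g f; apply SLHom_ext; intro phi; apply SLHom_ext; reflexivity).
Defined.

Definition join_closed (L : SupLat) (I : L -> Prop) : Prop :=
  forall S : L -> Prop, (forall x, S x -> I x) -> I (join S).

Definition SubSupLat (L : SupLat) := {I : L -> Prop | join_closed I}.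

Definition SubPre (L : SupLat) : Preorder :=
  @Build_Preorder (SubSupLat L)
    (fun I J => forall x, proj1_sig I x -> proj1_sig J x)
    (fun I x h => h) (fun I J K p q x h => q x (p x h)).

Definition Sub_preimage (M L : SupLat) (g : SLHom M L) (I : SubSupLat L) : SubSupLat M.
Proof.
  exists (fun x => proj1_sig I (g x)).
  abstract (intros S h; unfold SLapp; rewrite (proj2_sig g); apply (proj2_sig I);
    intros y [x [Sx e]]; rewrite e; exact (h x Sx)).
Defined.

Lemma Sub_preimage_monotone (M L : SupLat) (g : SLHom M L) :
  @monotone (SubPre L) (SubPre M) (Sub_preimage g).
Proof. intros I J h x; exact (h (g x)). Qed.

Definition Sub : Functor (op SL) PreOrd.
Proof.
  refine (@Build_Functor (op SL) PreOrd SubPre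
    (fun L M (g : SLHom M L) =>
       exist (@monotone (SubPre L) (SubPre M)) (Sub_preimage g) (@Sub_preimage_monotone M L g)) _ _).
  - abstract (intro L; apply sig_ext; apply functional_extensionality; intro I;
      apply sig_ext; reflexivity).
  - abstract (intros L M N g f; apply sig_ext; apply functional_extensionality; intro I;
      apply sig_ext; reflexivity).
Defined.

(** On objects [Sub (SL(L, Omega))]; [reindex P f Psi] is the set of [phi] with
    [SLcomp phi f] in [Psi]. *)
Definition P : Doctrine (op SL) := compF Sub (opF (homSL Omega)).

(** Finite meets exist in any suplattice, as joins of sets of lower bounds. *)
Definition meet (L : SupLat) (a b : L) : L := join (fun x => sle x a /\ sle x b).

Definition top (L : SupLat) : L := join (fun _ => True).

Definition is_frame (L : SupLat) : Prop :=
  forall (a : L) (S : L -> Prop), meet a (join S) = join (image (meet a) S).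

Definition preserves_finite_meets (X L : SupLat) (f : SLHom X L) : Prop :=
  f (top X) = top L /\ forall a b : X, f (meet a b) = meet (f a) (f b).

Lemma preserves_finite_meets_id (L : SupLat) : preserves_finite_meets (SLid L).
Proof. split; reflexivity. Qed.

Lemma preserves_finite_meets_comp (X Y Z : SupLat) (g : SLHom Y Z) (f : SLHom X Y) :
  preserves_finite_meets g -> preserves_finite_meets f ->
  preserves_finite_meets (SLcomp g f).
Proof.
  intros [gt gm] [ft fm]; split; simpl; unfold SLapp in *; simpl.
  - rewrite ft; exact gt.
  - intros a b; rewrite fm; apply gm.
Qed.

Definition Frm : Category :=
  @Subcategory SL is_frame (fun X L f => preserves_finite_meets f)
    (fun L _ => preserves_finite_meets_id L)
    (fun X Y Z g f _ _ _ hg hf => preserves_finite_meets_comp hg hf).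

Definition Frm_incl : Functor Frm SL :=
  @Subcategory_incl SL is_frame (fun X L f => preserves_finite_meets f) _ _.

Definition Loc : Category := op Frm.

Definition Loc_incl : Functor Loc (op SL) := opF Frm_incl.

Definition Ptilde : Doctrine Loc := restrict Loc_incl P.

Definition is_continuous (L1 L2 : SupLat) (Phi1 : SubSupLat (SLHomLat L1 Omega))
    (Phi2 : SubSupLat (SLHomLat L2 Omega)) (f : SLHom L2 L1) : Prop :=
  forall psi : SLHom L2 Omega,
    image (fun phi : SLHom L1 Omega => SLcomp phi f) (proj1_sig Phi1) psi ->
    proj1_sig Phi2 psi.

Lemma is_continuous_id (L : SupLat) (Phi : SubSupLat (SLHomLat L Omega)) :
  is_continuous Phi Phi (SLid L).
Proof.
  intros psi [phi [h e]]; rewrite e.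
  replace (SLcomp phi (SLid L)) with phi; [exact h | apply SLHom_ext; reflexivity].
Qed.

Lemma is_continuous_comp (L1 L2 L3 : SupLat) (Phi1 : SubSupLat (SLHomLat L1 Omega))
    (Phi2 : SubSupLat (SLHomLat L2 Omega)) (Phi3 : SubSupLat (SLHomLat L3 Omega))
    (g : SLHom L3 L2) (f : SLHom L2 L1) :
  is_continuous Phi2 Phi3 g -> is_continuous Phi1 Phi2 f ->
  is_continuous Phi1 Phi3 (SLcomp f g).
Proof.
  intros cg cf psi [phi [h e]]; apply cg.
  exists (SLcomp phi f); split.
  - apply cf; exists phi; split; [exact h | reflexivity].
  - rewrite e; apply SLHom_ext; reflexivity.
Qed.

Arguments is_continuous_id {L} Phi.
Arguments is_continuous_comp {L1 L2 L3 Phi1 Phi2 Phi3 g f}.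

Definition BTop : Category.
Proof.
  refine (@Build_Category {L : SupLat & SubSupLat (SLHomLat L Omega)}
    (fun X Y => {f : SLHom (projT1 Y) (projT1 X) | is_continuous (projT2 X) (projT2 Y) f})
    (fun X => exist _ (SLid (projT1 X)) (is_continuous_id (projT2 X)))
    (fun X Y Z g f => exist _ (SLcomp (proj1_sig f) (proj1_sig g))
       (is_continuous_comp (proj2_sig g) (proj2_sig f))) _ _ _);
  abstract (intros; apply sig_ext; apply SLHom_ext; reflexivity).
Defined.

Definition BTop_forget : Functor BTop (op SL) :=
  @Build_Functor BTop (op SL) (fun X => projT1 X) (fun X Y f => proj1_sig f)
    (fun _ => eq_refl) (fun _ _ _ _ _ => eq_refl).

(** This is the subcategory of [BTop] whose objects [(L, Phi)] have a frame [L] and whose arrows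
    are the frame homomorphisms among those of [BTop]; the pair is bracketed with the
    frame as its first component.  [PTop_subcategory] below checks that [PTop_incl]
    identifies it with that subcategory. *)
Definition PTop : Category.
Proof.
  refine (@Build_Category {L : Ob Frm & SubSupLat (SLHomLat (Frm_incl L) Omega)}
    (fun X Y => {f : @Hom Frm (projT1 Y) (projT1 X) |
                   is_continuous (projT2 X) (projT2 Y) (fhom Frm_incl f)})
    (fun X => exist _ (@idm Frm (projT1 X)) (is_continuous_id (projT2 X)))
    (fun X Y Z g f => exist _ (@comp Frm _ _ _ (proj1_sig f) (proj1_sig g))
       (is_continuous_comp (proj2_sig g) (proj2_sig f))) _ _ _).
  - abstract (intros X Y f; apply sig_ext; apply (@comp_idr Frm)).
  - abstract (intros X Y f; apply sig_ext; apply (@comp_idl Frm)).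
  - abstract (intros X Y Z W h g f; apply sig_ext; symmetry; apply (@comp_assoc Frm)).
Defined.

Definition PTop_forget : Functor PTop Loc :=
  @Build_Functor PTop Loc (fun X => projT1 X) (fun X Y f => proj1_sig f)
    (fun _ => eq_refl) (fun _ _ _ _ _ => eq_refl).

Definition PTop_incl : Functor PTop BTop :=
  @Build_Functor PTop BTop
    (fun X => existT (fun L => SubSupLat (SLHomLat L Omega)) (Frm_incl (projT1 X)) (projT2 X))
    (fun X Y f => exist _ (fhom Frm_incl (proj1_sig f)) (proj2_sig f))
    (fun X => eq_refl) (fun X Y Z g f => eq_refl).

(** [PTop_incl] is injective on objects and on arrows, and its image consists of the
    objects over frames and of the arrows that are frame homomorphisms. *)
Lemma PTop_subcategory :
  (forall X Y : Ob PTop, PTop_incl X = PTop_incl Y -> X = Y) /\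
  (forall Z : Ob BTop, (exists X : Ob PTop, PTop_incl X = Z) <-> is_frame (projT1 Z)) /\
  (forall (X Y : Ob PTop) (f g : Hom X Y), fhom PTop_incl f = fhom PTop_incl g -> f = g) /\
  (forall (X Y : Ob PTop) (h : Hom (PTop_incl X) (PTop_incl Y)),
     (exists f : Hom X Y, fhom PTop_incl f = h) <-> preserves_finite_meets (proj1_sig h)).
Proof.
  split; [|split; [|split]].
  - assert (R : forall (Z Z' : Ob BTop) (p : is_frame (projT1 Z)) (q : is_frame (projT1 Z')),
      Z = Z' -> existT (fun L : Ob Frm => SubSupLat (SLHomLat (Frm_incl L) Omega))
                  (exist _ (projT1 Z) p) (projT2 Z)
                = existT _ (exist _ (projT1 Z') q) (projT2 Z')).
    { intros Z Z' p q e; destruct e; rewrite (proof_irrel p q); reflexivity. }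
    intros [[L p] I] [[M q] J] e; exact (R (existT _ L I) (existT _ M J) p q e).
  - intros [L I]; split.
    + intros [X e]; rewrite <- e; exact (proj2_sig (projT1 X)).
    + intro h; exists (existT (fun L : Ob Frm => SubSupLat (SLHomLat (Frm_incl L) Omega))
        (exist _ L h) I); reflexivity.
  - intros X Y f g e; apply sig_ext; apply sig_ext.
    exact (f_equal (@proj1_sig _ _) e).
  - intros X Y h; split.
    + intros [f e]; rewrite <- e; exact (proj2_sig (proj1_sig f)).
    + intro m; exists (exist _ (exist _ (proj1_sig h) m) (proj2_sig h)).
      apply sig_ext; reflexivity.
Qed.

(* Main.v *)
Require Import Defs.
From Stdlib Require Import FunctionalExtensionality.

(** The categories compared have definitionally the same objects, and their arrows are
    the same maps carrying two equivalent conditions: by the definition of the image,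
    [Phi1 o f] lies in [Phi2] exactly when [Phi1] lies in [P(f)(Phi2)].  Equivalent
    conditions are equal propositions, so the hom-types, and with them the categories,
    are equal; this is [hom_subtype_category_eq].  That lemma also identifies the functor
    given by the equality with the evident functor that is the identity on objects and on
    underlying maps, which makes the compatibility of the equalities with the forgetful
    and inclusion functors a computation.

    The remaining claims hold for every doctrine.  The reindexing [(b, D(u)(y))] is a
    cartesian lift of [u : b -> U (a, y)] ([Groth_forget_fibration]).  A functor [K] into
    a Grothendieck construction is its composite with the forgetful functor together with
    a family of elements of the fibres ([Groth_functor_eta]); when the composite factors as
    [F o H], the same family, read over [H], is a functor into the Grothendieck
    construction of the restriction along [F], and this is the pullback property
    ([Groth_restrict_pullback]). *)

Set Implicit Arguments.
Unset Strict Implicit.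
Unset Printing Implicit Defensive.

(** * Equality of functors and of categories *)

Definition hom_of_eq (C : Category) (A B : Ob C) (e : A = B) : Hom A B :=
  match e in _ = X return Hom A X with eq_refl => idm A end.

Lemma fhom_hom_of_eq (C D : Category) (F : Functor C D) (A B : Ob C) (e : A = B) :
  fhom F (hom_of_eq e) = hom_of_eq (f_equal (fobj F) e).
Proof. destruct e; apply fhom_id. Qed.

(** Equality on arrows is expressed as naturality of the family of identities
    [hom_of_eq (e A)], which avoids transporting arrows between hom-types. *)
Lemma functor_ext (C D : Category) (F G : Functor C D) (e : forall A, F A = G A) :
  (forall A B (f : Hom A B),
     comp (hom_of_eq (e B)) (fhom F f) = comp (fhom G f) (hom_of_eq (e A))) ->
  F = G.
Proof.
  destruct F as [o h p q], G as [o' h' p' q']; simpl in *; intro n.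
  assert (eo : o = o') by (apply functional_extensionality; exact e).
  destruct eo.
  assert (eh : h = h').
  { apply functional_extensionality_dep; intro A.
    apply functional_extensionality_dep; intro B.
    apply functional_extensionality_dep; intro f.
    generalize (n A B f).
    rewrite (proof_irrel (e A) eq_refl), (proof_irrel (e B) eq_refl); simpl.
    rewrite comp_idl, comp_idr; trivial. }
  destruct eh; f_equal; apply proof_irrel.
Qed.

Lemma functor_eq_natural (C D : Category) (F G : Functor C D) (E : F = G)
    (e : forall A, F A = G A) (A B : Ob C) (f : Hom A B) :
  comp (hom_of_eq (e B)) (fhom F f) = comp (fhom G f) (hom_of_eq (e A)).
Proof.
  destruct E; rewrite (proof_irrel (e A) eq_refl), (proof_irrel (e B) eq_refl); simpl.
  rewrite comp_idl, comp_idr; reflexivity.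
Qed.

Lemma functor_ext_same_objects (C D : Category) (o : Ob C -> Ob D)
    (h h' : forall A B : Ob C, Hom A B -> Hom (o A) (o B)) p q p' q' :
  (forall A B f, h A B f = h' A B f) ->
  @Build_Functor C D o h p q = @Build_Functor C D o h' p' q'.
Proof.
  intro n; apply (@functor_ext C D (Build_Functor p q) (Build_Functor p' q')
    (fun A => eq_refl)).
  intros A B f; simpl; rewrite comp_idl, comp_idr; apply n.
Qed.

(** Both categories have arrows [H X Y] cut down by a condition, with the same underlying
    identities and composites; equivalence of the conditions is enough for equality. *)
Lemma hom_subtype_category_eq (O : Type) (H : O -> O -> Type)
    (i : forall X, H X X) (c : forall X Y Z, H Y Z -> H X Y -> H X Z)
    (p q : forall X Y, H X Y -> Prop)
    (pi : forall X, p X X (i X)) (qi : forall X, q X X (i X))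
    (pc : forall X Y Z (g : sig (p Y Z)) (f : sig (p X Y)),
       p X Z (c X Y Z (proj1_sig g) (proj1_sig f)))
    (qc : forall X Y Z (g : sig (q Y Z)) (f : sig (q X Y)),
       q X Z (c X Y Z (proj1_sig g) (proj1_sig f)))
    pl pr pa ql qr qa
    (C := @Build_Category O (fun X Y => sig (p X Y)) (fun X => exist _ (i X) (pi X))
            (fun X Y Z g f => exist _ (c X Y Z (proj1_sig g) (proj1_sig f)) (pc X Y Z g f))
            pl pr pa)
    (D := @Build_Category O (fun X Y => sig (q X Y)) (fun X => exist _ (i X) (qi X))
            (fun X Y Z g f => exist _ (c X Y Z (proj1_sig g) (proj1_sig f)) (qc X Y Z g f))
            ql qr qa)
    (j : forall X Y, sig (p X Y) -> sig (q X Y)) j1 j2 :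
  (forall X Y f, p X Y f <-> q X Y f) ->
  (forall X Y f, proj1_sig (j X Y f) = proj1_sig f) ->
  exists e : C = D, idF_of_eq e = @Build_Functor C D (fun X => X) j j1 j2.
Proof.
  intros pq ej.
  assert (epq : p = q).
  { apply functional_extensionality_dep; intro X.
    apply functional_extensionality_dep; intro Y.
    apply pred_ext; apply pq. }
  destruct epq.
  destruct (proof_irrel pi qi), (proof_irrel pc qc).
  destruct (proof_irrel pl ql), (proof_irrel pr qr), (proof_irrel pa qa).
  exists eq_refl; apply functor_ext_same_objects.
  intros X Y f; apply sig_ext; symmetry; apply ej.
Qed.

(** * Grothendieck constructions *)

Lemma Groth_forget_fibration (C : Category) (D : Doctrine C) :
  is_fibration (Groth_forget D).
Proof.
  intros [a y] b u; simpl in u.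
  exists (existT (fun A => pcar (D A)) b (reindex D u y)).
  exists (exist _ u (ple_refl (reindex D u y))).
  split; [reflexivity|].
  intros [z t] [g hg] w; simpl in *; intro e.
  assert (hw : ple t (reindex D w (reindex D u y)))
    by (rewrite <- reindex_comp, e; exact hg).
  exists (exist _ w hw); split.
  - split; [reflexivity | apply sig_ext; exact e].
  - intros h [eh _]; apply sig_ext; symmetry; exact eh.
Qed.

Lemma Groth_hom_of_eq (C : Category) (D : Doctrine C) (X Y : Ob (Groth D)) (e : X = Y)
    (e1 : projT1 X = projT1 Y) :
  proj1_sig (hom_of_eq e) = hom_of_eq e1.
Proof.
  rewrite (proof_irrel e1 (f_equal (@projT1 _ _) e)).
  exact (fhom_hom_of_eq (Groth_forget D) e).
Qed.

(** An arrow of the Grothendieck construction is an arrow of the base with a property, so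
    beyond the forgetful composite only the values on objects matter. *)
Lemma Groth_functor_ext (X C : Category) (D : Doctrine C) (u v : Functor X (Groth D)) :
  compF (Groth_forget D) u = compF (Groth_forget D) v -> (forall x, u x = v x) -> u = v.
Proof.
  intros E e; apply (functor_ext (e := e)); intros A B f; apply sig_ext; simpl.
  assert (e1 : forall x, projT1 (u x) = projT1 (v x)) by (intro x; rewrite e; reflexivity).
  rewrite (Groth_hom_of_eq (e A) (e1 A)), (Groth_hom_of_eq (e B) (e1 B)).
  exact (functor_eq_natural E e1 f).
Qed.

Definition Groth_lift (X C : Category) (D : Doctrine C) (K0 : Functor X C)
    (phi : forall x, pcar (D (K0 x)))
    (h : forall x y (f : Hom x y), ple (phi x) (reindex D (fhom K0 f) (phi y))) :
    Functor X (Groth D).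
Proof.
  refine (@Build_Functor X (Groth D) (fun x => existT _ (K0 x) (phi x))
    (fun x y f => exist _ (fhom K0 f) (h x y f)) _ _).
  - abstract (intro x; apply sig_ext; apply fhom_id).
  - abstract (intros x y z g f; apply sig_ext; apply fhom_comp).
Defined.

Lemma Groth_forget_lift (X C : Category) (D : Doctrine C) (K0 : Functor X C)
    (phi : forall x, pcar (D (K0 x))) h :
  compF (Groth_forget D) (@Groth_lift X C D K0 phi h) = K0.
Proof. destruct K0; apply functor_ext_same_objects; reflexivity. Qed.

(** The base functor is a variable [K0] rather than the forgetful composite itself, so that
    the family of elements can be read over any functor equal to it. *)
Lemma Groth_functor_eta (X C : Category) (D : Doctrine C) (K : Functor X (Groth D))
    (K0 : Functor X C) :
  compF (Groth_forget D) K = K0 ->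
  exists (phi : forall x, pcar (D (K0 x))) h, @Groth_lift X C D K0 phi h = K.
Proof.
  intro E; destruct E.
  exists (fun x => projT2 (K x)), (fun x y f => proj2_sig (fhom K f)).
  apply Groth_functor_ext.
  - apply Groth_forget_lift.
  - intro x; simpl; symmetry; apply sigT_eta.
Qed.

Lemma Groth_incl_inj (B C : Category) (F : Functor B C) (D : Doctrine C)
    (X Y : Ob (Groth (restrict F D))) :
  projT1 X = projT1 Y -> Groth_incl F D X = Groth_incl F D Y -> X = Y.
Proof.
  destruct X as [a x], Y as [b y]; simpl; intros e E; destruct e; f_equal.
  generalize (projT2_eq E); rewrite (proof_irrel (projT1_eq E) eq_refl); trivial.
Qed.

Lemma Groth_restrict_pullback (B C : Category) (F : Functor B C) (D : Doctrine C) :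
  is_pullback_Cat (Groth_incl F D) (Groth_forget (restrict F D)) (Groth_forget D) F.
Proof.
  split.
  - apply functor_ext_same_objects; reflexivity.
  - intros X H K E.
    destruct (Groth_functor_eta (eq_sym E)) as [phi [h eK]].
    (* The fibre of the restricted doctrine over [H x] is that of [D] over [F (H x)]. *)
    exists (@Groth_lift X B (restrict F D) H phi h); split.
    + split; [apply Groth_forget_lift|].
      rewrite <- eK; apply functor_ext_same_objects; reflexivity.
    + intros v [eH eK'].
      apply Groth_functor_ext.
      * rewrite eH; apply Groth_forget_lift.
      * intro x; apply Groth_incl_inj.
        -- simpl; rewrite <- eH; reflexivity.
        -- rewrite <- eK in eK'.
           exact (eq_sym (f_equal (fun G : Functor X (Groth D) => G x) eK')).
Qed.

(** * Basic and positive topologies *)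

Lemma is_continuous_iff (L1 L2 : SupLat) (Phi1 : SubSupLat (SLHomLat L1 Omega))
    (Phi2 : SubSupLat (SLHomLat L2 Omega)) (f : SLHom L2 L1) :
  (forall phi, proj1_sig Phi1 phi -> proj1_sig Phi2 (SLcomp phi f)) <->
  is_continuous Phi1 Phi2 f.
Proof.
  split.
  - intros h psi [phi [i e]]; rewrite e; exact (h phi i).
  - intros h phi i; apply h; exists phi; split; [exact i | reflexivity].
Qed.

Definition Groth_to_BTop : Functor (Groth P) BTop.
Proof.
  refine (@Build_Functor (Groth P) BTop (fun X => X)
    (fun X Y f => exist _ (proj1_sig f)
       (proj1 (is_continuous_iff (projT2 X) (projT2 Y) (proj1_sig f)) (proj2_sig f))) _ _);
  abstract (intros; apply sig_ext; reflexivity).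
Defined.

Definition Groth_to_PTop : Functor (Groth Ptilde) PTop.
Proof.
  refine (@Build_Functor (Groth Ptilde) PTop (fun X => X)
    (fun X Y f => exist _ (proj1_sig f)
       (proj1 (is_continuous_iff (projT2 X) (projT2 Y) (fhom Frm_incl (proj1_sig f)))
          (proj2_sig f))) _ _);
  abstract (intros; apply sig_ext; reflexivity).
Defined.

Lemma Groth_eq_BTop : exists e : Groth P = BTop, idF_of_eq e = Groth_to_BTop.
Proof.
  refine (@hom_subtype_category_eq {L : SupLat & SubSupLat (SLHomLat L Omega)}
    (fun X Y => SLHom (projT1 Y) (projT1 X)) (fun X => SLid (projT1 X))
    (fun X Y Z g f => SLcomp f g) _ _ _ _ _ _ _ _ _ _ _ _ _ _ _ _ _).
  - intros X Y f; apply (is_continuous_iff (projT2 X) (projT2 Y) f).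
  - reflexivity.
Qed.

Lemma Groth_eq_PTop : exists e : Groth Ptilde = PTop, idF_of_eq e = Groth_to_PTop.
Proof.
  refine (@hom_subtype_category_eq
    {L : Ob Frm & SubSupLat (SLHomLat (Frm_incl L) Omega)}
    (fun X Y => @Hom Frm (projT1 Y) (projT1 X)) (fun X => @idm Frm (projT1 X))
    (fun X Y Z g f => @comp Frm _ _ _ f g) _ _ _ _ _ _ _ _ _ _ _ _ _ _ _ _ _).
  - intros X Y f; apply (is_continuous_iff (projT2 X) (projT2 Y) (fhom Frm_incl f)).
  - reflexivity.
Qed.

Theorem mainTheorem1 :
  exists eB : Groth P = BTop,
    compF BTop_forget (idF_of_eq eB) = Groth_forget P /\
    is_fibration (Groth_forget P) /\
    exists eP : Groth Ptilde = PTop,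
      compF PTop_forget (idF_of_eq eP) = Groth_forget Ptilde /\
      compF PTop_incl (idF_of_eq eP) = compF (idF_of_eq eB) (Groth_incl Loc_incl P) /\
      is_fibration (Groth_forget Ptilde) /\
      is_pullback_Cat (Groth_incl Loc_incl P) (Groth_forget Ptilde)
        (Groth_forget P) Loc_incl.
Proof.
  destruct Groth_eq_BTop as [eB hB], Groth_eq_PTop as [eP hP].
  exists eB; rewrite hB; split; [|split].
  - apply functor_ext_same_objects; reflexivity.
  - apply Groth_forget_fibration.
  - exists eP; rewrite hP; split; [|split; [|split]].
    + apply functor_ext_same_objects; reflexivity.
    + apply functor_ext_same_objects; intros X Y f; apply sig_ext; reflexivity.
    + apply Groth_forget_fibration.
    + apply Groth_restrict_pullback.
Qed.
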